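(* Suppose that the following hold. (K-a) For every compact subset $Z_0\subset Z$ with projection $X_0$ on $X$, the set $\{k(\cdot,x):x\in X_0\}$ is equi-continuous on $X_0$, i.e. for every $\epsilon>0$ there is $\eta>0$ such that $\|k(\cdot,x')-k(\cdot,x)\|_k<\epsilon$ for all $x,x'\in X_0$ with $\|x'-x\|<\eta$. (K-b) There is a constant $\beta>0$ such that $\|f\|_k\le\beta$ for all $f\in\mathcal F$. (C-a) There is a gauge function $\phi:Z\to[0,\infty)$ such that $c(z,f(x))\le\phi(z)$ for all $z=(x,y)\in Z$ and $f\in\mathcal F$, and $\phi(z)\to\infty$ as $\|z\|\to\infty$. (C-b) $c:Z\times Y\to\mathbb R$ is continuous. Then for every $p\ge 1$ and every $P\in\mathcal M_Z^{\phi^p}$, $$\lim_{P'\xrightarrow{\phi^p}P}\vartheta(P')=\vartheta(P),$$ i.e. $\vartheta:\mathcal M_Z^{\phi^p}\to\mathbb R$ is continuous at $P$ with respect to the $\phi^p$-weak topology $\tau_{\phi^p}$.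
   Context: Setting. $X$ is the input space and $Y\subseteq\mathbb R$ the output space; $X$ and $Z:=X\times Y$ are subsets of normed spaces, with norms denoted $\|\cdot\|$, and $Z$ is Polish; elements of $Z$ are written $z=(x,y)$. $\mathscr P(Z)$ is the set of Borel probability measures on $Z$. $k:X\times X\to\mathbb R$ is a given positive definite symmetric kernel (all matrices $[k(x_i,x_j)]_{ij}$ are symmetric positive semidefinite), $\mathcal H_k$ is its reproducing kernel Hilbert space (so $k(\cdot,x)\in\mathcal H_k$ and $f(x)=\langle f,k(\cdot,x)\rangle$ for $f\in\mathcal H_k$, $x\in X$), with norm $\|\cdot\|_k$. $\mathcal F$ is a (nonempty) subset of $\mathcal H_k$ of functions $X\to Y$. The cost function $c:Z\times Y\to\mathbb R$ is such that $c(z,f(x))\ge 0$. Optimal value: $\vartheta(P):=\inf_{f\in\mathcal F}\mathbb E_P[c(z,f(x))]=\inf_{f\in\mathcal F}\int_Z c(z,f(x))\,P(dz)$. A gauge function is a continuous $\phi:Z\to[0,\infty)$ with $\phi\ge 1$ outside a compact set. For such a function $\psi$ (here $\psi=\phi^p$, $\phi^p(z):=\phi(z)^p$), $\mathcal M_Z^{\psi}:=\{P\in\mathscr P(Z):\int_Z\psi\,dP<\infty\}$. The $\psi$-weak topology $\tau_\psi$ on $\mathcal M_Z^\psi$ is the coarsest topology making all maps $P\mapsto\int_Z h\,dP$ continuous, where $h$ ranges over the continuous functions $h:Z\to\mathbb R$ for which there is a constant $C>0$ with $|h(z)|\le C(\psi(z)+1)$ for all $z\in Z$. $P'\xrightarrow{\psi}P$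 denotes convergence with respect to $\tau_\psi$.
   Formalization: ''Z is Polish'' is taken to mean that Z is separable and complete for its norm distance; if Z is only completely metrizable the claim fails, e.g. X=[0,1], Y=(0,1], k=1, F the constants in Y, φ=1, c=1−max(0,1−|x/a−1|). *)

(* Defs.v *)
From HB Require Import structures.
From mathcomp Require Import all_boot all_order all_algebra.
From mathcomp Require Import all_classical all_reals all_analysis.

Set Implicit Arguments.
Unset Strict Implicit.
Unset Printing Implicit Defensive.

Import Order.TTheory GRing.Theory Num.Theory.
Import numFieldNormedType.Exports.

Local Open Scope classical_set_scope.
Local Open Scope ring_scope.

Definition psd_kernel {R : realType} {T : Type} (k : T -> T -> R) : Prop :=
  (forall x y, k x y = k y x) /\
  (forall (n : nat) (x : 'I_n -> T) (a : 'I_n -> R),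
     0 <= \sum_(i < n) \sum_(j < n) a i * a j * k (x i) (x j)).

Definition dot_norm {R : realType} {V : Type} (dot : V -> V -> R) (f : V) : R :=
  Num.sqrt (dot f f).

(* A real Hilbert space of functions on T in which evaluation at x is the inner
   product with k(., x).  The inner product is total and is constrained only on
   the carrier.  By Moore-Aronszajn such a space is unique for a positive
   semidefinite k. *)
Record rkhs (R : realType) (T : Type) (k : T -> T -> R) := RKHS {
  rkhs_carrier : set (T -> R);
  rkhs_dot : (T -> R) -> (T -> R) -> R;
  rkhs0 : rkhs_carrier (fun=> 0);
  rkhs_linear : forall a f g, rkhs_carrier f -> rkhs_carrier g ->
    rkhs_carrier (fun x => a * f x + g x);
  rkhs_dotC : forall f g, rkhs_carrier f -> rkhs_carrier g ->
    rkhs_dot f g = rkhs_dot g f;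
  rkhs_dotDl : forall a f g h,
    rkhs_carrier f -> rkhs_carrier g -> rkhs_carrier h ->
    rkhs_dot (fun x => a * f x + g x) h = a * rkhs_dot f h + rkhs_dot g h;
  rkhs_dot_gt0 : forall f, rkhs_carrier f -> f <> (fun=> 0) ->
    0 < rkhs_dot f f;
  rkhs_complete : forall u : nat -> T -> R, (forall n, rkhs_carrier (u n)) ->
    (forall e, 0 < e -> exists N : nat, forall m n, (N <= m)%N -> (N <= n)%N ->
       dot_norm rkhs_dot (fun x => u m x - u n x) < e) ->
    exists2 f, rkhs_carrier f &
      (fun n => dot_norm rkhs_dot (fun x => u n x - f x)) @ \oo --> (0 : R);
  rkhs_section : forall x, rkhs_carrier (k^~ x);
  rkhs_reproducing : forall f x, rkhs_carrier f -> f x = rkhs_dot f (k^~ x)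
}.

Definition rkhs_norm {R : realType} {T : Type} {k : T -> T -> R} (H : rkhs k)
  (f : T -> R) : R := dot_norm (rkhs_dot H) f.

(* Complete separable metric space for the given metric: for a subset of a
   normed space this is completeness for the norm distance, not only
   complete metrizability of the topology. *)
Definition polish {R : realType} (T : pseudoMetricType R) : Prop :=
  [/\ hausdorff_space T,
      exists2 D : set T, countable D & dense D
    & forall F : set_system T, ProperFilter F -> cauchy F ->
      exists l : T, F --> l].

(* Measurable types of the library are pointed; the base point t0 plays no other
   role than to witness that T is nonempty. *)
Definition pointed_at {T : Type} (t0 : T) : Type := T.

HB.instance Definition _ (T : choiceType) (t0 : T) :=
  Choice.copy (pointed_at t0) T.
HB.instance Definition _ (T : choiceType) (t0 : T) :=
  isPointed.Build (pointed_at t0) t0.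

Definition pointed_open {T : topologicalType} (t0 : T) :
  set (set (pointed_at t0)) := @open T.

Notation borel t0 := (g_sigma_algebraType (@pointed_open _ t0)).

Definition gauge {R : realType} {T : topologicalType} (phi : T -> R) : Prop :=
  [/\ continuous phi,
      forall z, 0 <= phi z
    & exists2 K : set T, compact K & forall z, ~ K z -> 1 <= phi z].

Section psi_weak_topology.
Context {R : realType} {T : topologicalType} (t0 : T) (psi : T -> R).

Definition moment_space : Type :=
  set_type [set P : probability (borel t0) R |
             (\int[P]_z (psi z)%:E < +oo)%E].

Definition psi_test : Type :=
  {h : T -> R | continuous h /\
     exists2 C : R, 0 < C & forall z, `|h z| <= C * (psi z + 1)}.

(* Test functions are integrable on [moment_space] (for psi >= 0), so this real
   integral is the actual one. *)
Definition psi_eval (h : psi_test) (P : moment_space) : R :=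
  \int[val P]_z (sval h z).

(* [moment_space] with the coarsest topology making every [psi_eval h]
   continuous. *)
Definition psi_weak : Type :=
  sup_topology (fun h : psi_test =>
    Topological.class (initial_topology (psi_eval h))).

HB.instance Definition _ := Topological.on psi_weak.

End psi_weak_topology.

Definition optval {R : realType} {X Y : topologicalType} {z0 : X * Y}
    (c : (X * Y) * Y -> R) (F : set (X -> Y))
    (P : probability (borel z0) R) : \bar R :=
  ereal_inf [set 'E_P[fun z : X * Y => c (z, f z.1)]%E | f in F].

(* Main.v *)
(** The functions in [F] are equicontinuous at every point (reproducing property,
    [K-b], and [K-a] applied to a convergent sequence with its limit) and locally
    bounded, with values in a closed set [Y]; hence the costs
    [g_f (z) = c (z, f z.1)] are equicontinuous at every point, and
    [0 <= g_f <= phi <= phi ^ p + 1].  By separability, countably many open sets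
    on which all [g_f] oscillate by at most [e] cover [Z].  With continuous
    functions [v_i >= 0] supported in the first [N] of them and with sum
    [W <= 1], the integral of [g_f] against any [Q] is within
    [e + \int phi (1 - W) dQ] of [\sum_i g_f(z_i) \int v_i dQ].  Both [v_i] and
    [phi (1 - W)] are test functions of the psi-weak topology, and
    [\int phi (1 - W) dP] is small for large [N] by dominated convergence; so
    integrals of the [g_f] against [Q] converge uniformly in [f] as [Q] tends to
    [P], whence so do their infima. *)
Require Import Defs.
From HB Require Import structures.
From mathcomp Require Import all_boot all_order all_algebra.
From mathcomp Require Import all_classical all_reals all_analysis.
From mathcomp Require Import measurable_realfun ring lra.

Set Implicit Arguments.
Unset Strict Implicit.
Unset Printing Implicit Defensive.

Import Order.TTheory GRing.Theory Num.Theory.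
Import numFieldNormedType.Exports.

Local Open Scope classical_set_scope.
Local Open Scope ring_scope.

(** * Compactness, ultrafilters and neighbourhoods in subspaces *)

(** A neighbourhood that works for the limit absorbs all but finitely many terms, and the remaining
    finite set is compact. *)
Lemma compact_cvg_seq (T : topologicalType) (u : nat -> T) (l : T) :
  u @ \oo --> l -> compact (range u `|` [set l]).
Proof.
move=> ul; apply/compact_near_coveringP => I G Pr FG cov.
have [/= [U V] [/= nU GV] UV] := cov l (or_intror erefl).
have [N _ uN] : \forall n \near \oo, U (u n) by apply: ul nU.
have fin : compact (u @` `I_N) by exact/finite_compact/finite_image.
have {}fin : \forall i \near G, (u @` `I_N) `<=` Pr i.
  move/compact_near_coveringP : fin; apply => // x [n _ <-]; apply: cov.
  by left; exists n.
near=> i => x [[n _ <-]|->].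
- have [nN|Nn] := ltnP n N.
    by apply: (near fin i) => //; exists n.
  apply: (UV (u n, i)); split => /=; first exact: uN.
  by near: i.
- apply: (UV (l, i)); split => /=; first exact: nbhs_singleton.
  by near: i.
Unshelve. all: by end_near. Qed.

Lemma set_type_continuous_val (T : topologicalType) (A : set T) : continuous (val : A -> T).
Proof. exact: initial_continuous. Qed.

Lemma nbhs_set_typeP {R : realType} (V : normedModType R) (A : set V) (x : A) (B : set A) :
  nbhs x B <-> exists2 e : R, 0 < e & forall y : A, `|val y - val x| < e -> B y.
Proof.
apply: (iff_trans (nbhs_ballP _ _)); split=> -[e e0 Be]; exists e => // y.
- by move=> yx; apply: Be; rewrite -initial_ballE /= -ball_normE /= distrC.
- by rewrite -initial_ballE /= -ball_normE /= distrC; exact: Be.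
Qed.

Lemma fmap_ultrafilter (S T : Type) (f : S -> T) (U : set_system S) :
  UltraFilter U -> UltraFilter (f @ U).
Proof.
move=> UU; split; first exact: fmap_proper_filter.
move=> G PG UG; apply/seteqP; split=> // A GA.
have [//|UnA] := in_ultra_setVsetC (f @^-1` A) UU.
have GnA : G (~` A) by exact: UG.
by have [x []] := filter_ex (filterI GA GnA).
Qed.

(** An ultrafilter on a bounded part of [Y] converges in [R] by Heine-Borel. Paired with a fixed
    point of [X] it is Cauchy in [X * Y], and completeness of the product puts its limit in [Y]. *)
Lemma polish_bounded_compact (R : realType) (E : normedModType R) (X : set E) (Y : set R) :
  polish (X * Y)%type -> X !=set0 ->
  forall M : R, compact [set y : Y | `|val y| <= M].
Proof.
move=> [_ _ compl] [x0 Xx0] M; rewrite compact_ultra => U UU UM.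
have cptM : compact [set y : R | `|y| <= M].
  rewrite (_ : mkset _ = `[- M, M]%classic); first exact: segment_compact.
  by apply/seteqP; split=> y /=; rewrite in_itv/= -ler_norml.
move: cptM; rewrite compact_ultra => cptM.
have [l [lM Ul]] := cptM ((val : Y -> R) @ U) (fmap_ultrafilter _ UU) UM. 
pose x1 : X := exist _ x0 (mem_set Xx0).
pose G : set_system (X * Y) := (fun y : Y => (x1, y)) @ U.
have /(compl G) [l' Gl'] : cauchy G.
  apply/cauchy_ballP => e e0; rewrite near_map2.
  pose B := [set y : Y | `|val y - l| < e / 2].
  have UB : U B.
    apply: (Ul [set y : R | `|y - l| < e / 2]).
    have e20 : 0 < e / 2 by rewrite divr_gt0.
    by apply/nbhs_ballP; exists (e / 2) => //= y; rewrite -ball_normE /= distrC.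
  exists (B, B); first by split.
  move=> [y y'] [/= yl y'l]; split; first exact: ballxx.
  rewrite /= -initial_ballE /= -ball_normE /=.
  have := ler_normB (val y - l) (val y' - l).
  rewrite opprB addrA subrK => /le_lt_trans; apply.
  by rewrite (splitr e) ltrD.
have Ul' : U --> l'.2.
  move=> A Al'; apply: (Gl' (snd @^-1` A)).
  by case: (l') Al' => a b /=; exact: (@cvg_snd _ _ (nbhs a)).
exists l'.2; split => //=.
(* By uniqueness of limits in [R], [val l'.2] is [l], which satisfies the bound [M]. *)
have vl : val @ U --> (val l'.2 : R) by exact: cvg_comp Ul' (@set_type_continuous_val _ _ _).
by rewrite (@cvg_unique _ (@Rhausdorff R) _ _ _ _ vl Ul).
Qed.

(** * Reproducing kernel Hilbert spaces *)

Section rkhs_theory.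
Context {R : realType} {T : Type} {k : T -> T -> R} (H : rkhs k).
Local Notation dot := (rkhs_dot H).
Local Notation carrier := (rkhs_carrier H).

Lemma rkhs_carrierB f g : carrier f -> carrier g -> carrier (fun x => f x - g x).
Proof.
move=> Hf Hg; rewrite (_ : (fun _ => _) = fun x => -1 * g x + f x).
  exact: rkhs_linear.
by apply/funext => x; rewrite mulN1r addrC.
Qed.

Lemma rkhs_dotDr a f g h : carrier f -> carrier g -> carrier h ->
  dot h (fun x => a * f x + g x) = a * dot h f + dot h g.
Proof.
move=> Hf Hg Hh; rewrite !(rkhs_dotC Hh)//; last exact: rkhs_linear.
exact: rkhs_dotDl.
Qed.

Lemma rkhs_dot_ge0 f : carrier f -> 0 <= dot f f.
Proof.
move=> Hf; have [->|f0] := pselect (f = fun=> 0); last exact/ltW/rkhs_dot_gt0.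
(* Since [1 * 0 + 0 = 0], linearity reads [d = d + d] for the inner product [d] of the zero function
   with itself. *)
have H0 := rkhs0 H; have := rkhs_dotDl 1 H0 H0 H0.
rewrite (_ : (fun _ => _) = fun=> 0); last by apply/funext => x; rewrite mul1r addr0.
lra.
Qed.

(** The square norm of [a * f + g] is a nonnegative quadratic polynomial in [a]. *)
Lemma rkhs_cauchy_schwarz f g : carrier f -> carrier g ->
  `|dot f g| <= rkhs_norm H f * rkhs_norm H g.
Proof.
move=> Hf Hg; have ff0 := rkhs_dot_ge0 Hf; have gg0 := rkhs_dot_ge0 Hg.
rewrite /rkhs_norm /dot_norm -sqrtrM// -sqrtr_sqr ler_wsqrtr//.
have quad a : 0 <= a ^+ 2 * dot f f + 2 * a * dot f g + dot g g.
  have := rkhs_dot_ge0 (rkhs_linear a Hf Hg).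
  have Hafg := rkhs_linear a Hf Hg.
  rewrite rkhs_dotDl// !rkhs_dotDr// (rkhs_dotC Hg Hf); lra.
have [ff|ff] := eqVneq (dot f f) 0.
  have [fg|fg] := eqVneq (dot f g) 0; first by rewrite ff fg expr0n mul0r.
  (* When [dot f f = 0] the polynomial is affine; this [a] would give it the value [-1]. *)
  have := quad (- (dot g g + 1) / (2 * dot f g)).
  rewrite ff mulr0 add0r.
  have -> : 2 * (- (dot g g + 1) / (2 * dot f g)) * dot f g = - (dot g g + 1).
    by field.
  lra.
have ffp : 0 < dot f f by rewrite lt_def ff.
(* The minimiser of the quadratic. *)
have := quad (- dot f g / dot f f).
rewrite (_ : _ + _ = dot g g - dot f g ^+ 2 / dot f f); last by field.
by rewrite subr_ge0 ler_pdivrMr// mulrC.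
Qed.

Lemma rkhs_eval_le f x : carrier f ->
  `|f x| <= rkhs_norm H f * rkhs_norm H (k^~ x).
Proof.
move=> Hf; rewrite (rkhs_reproducing _ Hf).
by apply: rkhs_cauchy_schwarz => //; exact: rkhs_section.
Qed.

(** With a common bound on the norms of the [f], this turns continuity of [x |-> k(., x)] into
    equicontinuity. *)
Lemma rkhs_evalB_le f x x' : carrier f ->
  `|f x' - f x| <= rkhs_norm H f * rkhs_norm H (fun t => k t x' - k t x).
Proof.
move=> Hf; have Hx := rkhs_section H x; have Hx' := rkhs_section H x'.
have -> : f x' - f x = dot f (fun t => k t x' - k t x).
  rewrite (_ : (fun _ => _) = fun t => -1 * k t x + k t x').
    by rewrite rkhs_dotDr// -!rkhs_reproducing// mulN1r addrC.
  by apply/funext => t; rewrite mulN1r addrC.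
by apply: rkhs_cauchy_schwarz => //; exact: rkhs_carrierB.
Qed.

Lemma rkhs_norm_ge0 f : 0 <= rkhs_norm H f.
Proof. exact: sqrtr_ge0. Qed.

End rkhs_theory.

(* A convergent sequence together with its limit is compact, so equicontinuity
   on compact sets suffices. *)
Lemma rkhs_section_continuous (R : realType) (E : normedModType R) (X : set E) (S : topologicalType)
  (s0 : S) (k : X -> X -> R) (H : rkhs k) :
  (forall Z0 : set (X * S), compact Z0 ->
     let X0 := [set z.1 | z in Z0] in
     forall eps : R, 0 < eps -> exists2 eta : R, 0 < eta &
       forall x x' : X, X0 x -> X0 x' -> `|val x' - val x| < eta ->
         rkhs_norm H (fun t => k t x' - k t x) < eps) ->
  forall (x : X) (e : R), 0 < e ->
    \forall x' \near x, rkhs_norm H (fun t => k t x' - k t x) < e.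
Proof.
move=> Ka x e e0; apply: contrapT => nx.
have {}nx (n : nat) : exists x' : X, `|val x' - val x| < n.+1%:R^-1 /\
    e <= rkhs_norm H (fun t => k t x' - k t x).
  apply: contrapT => nx'; apply: nx; apply/nbhs_set_typeP.
  exists n.+1%:R^-1 => // x' xx'; rewrite ltNge; apply/negP => ex'.
  by apply: nx'; exists x'.
have [u u_] := choice nx.
have ux : u @ \oo --> x.
  move=> A /nbhs_set_typeP[r r0 rA]; suff : \forall n \near \oo, A (u n) by [].
  near=> n; apply: rA; apply: (lt_trans (u_ n).1).
  by near: n; exact: near_infty_natSinv_lt (PosNum r0).
(* The hypothesis is about compact subsets of [X * S], so the sequence is lifted with constant
   second coordinate [s0]. *)
have vs : (fun n => (u n, s0)) @ \oo --> (x, s0).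
  by apply: (cvg_pair (G := nbhs x) (H := nbhs s0)) ux _; exact: cvg_cst.
have [eta eta0 Keta] := Ka _ (compact_cvg_seq vs) e e0.
have /filter_ex[n nP] : \forall n \near \oo, `|val (u n) - val x| < eta.
  by apply: (ux [set x' : X | `|val x' - val x| < eta]); apply/nbhs_set_typeP; exists eta.
have := (u_ n).2; rewrite leNgt => /negP; apply; apply: Keta => //.
  by exists (x, s0) => //; right.
by exists (u n, s0) => //; left; exists n.
Unshelve. all: by end_near. Qed.

(** * Equicontinuity of the costs *)

(** At a single [y] this is continuity of [c] at [(s, y)]. The near-covering form of compactness
    makes the choice common to all [y] in [K]; its parameter is the pair [(s', d)], with [d] tending
    to [0] from the right. *)
Lemma compact_tube (R : realType) (S : topologicalType) (V : normedModType R) (Y : set V)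
    (c : S * Y -> R) (K : set Y) (s : S) (e : R) :
  continuous c -> compact K -> 0 < e ->
  exists2 d : R, 0 < d & \forall s' \near s, forall y y' : Y, K y ->
    `|val y' - val y| < d -> `|c (s', y') - c (s, y)| < e.
Proof.
move=> cc /compact_near_coveringP cK e0.
pose P (i : S * R) (y : Y) := forall y' : Y,
  `|val y' - val y| < i.2 -> `|c (i.1, y') - c (s, y)| < e.
have /cK : forall y, K y ->
    \forall y' \near y & i \near filter_prod (nbhs s) 0^'+, P i y'.
  move=> y _; have e20 : 0 < e / 2 by rewrite divr_gt0.
  have [[A B] /= [nA /nbhs_set_typeP[r r0 rB]] AB] :
      \forall t \near (s, y), `|c (s, y) - c t| < e / 2.
    by have /cvgrPdist_lt := cc (s, y); apply.
  have r20 : 0 < r / 2 by rewrite divr_gt0.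
  (* Half of [r] for the distance from [y] to [y'] and half for that from [y'] to [y''], so that
     [y''] is still within [r] of [y]. *)
  exists ([set y' : Y | `|val y' - val y| < r / 2],
          [set i | A i.1 /\ i.2 < r / 2]) => /=.
    split; first by apply/nbhs_set_typeP; exists (r / 2).
    exists (A, [set x | x < r / 2]) => //=.
      by split => //; exact: nbhs_right_lt.
  move=> [y' [s' d]] /= [yy' [As' dr]] y'' /= y''d.
  have /AB /= c1 : (A `*` B) (s', y'').
    split => //; apply: rB; rewrite (splitr r) (le_lt_trans (ler_distD (val y') _ _))//.
    by rewrite ltrD// (lt_trans y''d).
  have /AB /= c2 : (A `*` B) (s, y').
    split => /=; first exact: nbhs_singleton.
    by apply: rB; rewrite (lt_trans yy')// ltr_pdivrMr// ltr_pMr// ltr1n.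
  have := ler_distD (c (s, y)) (c (s', y'')) (c (s, y')).
  by rewrite (distrC _ (c (s, y))) /=; lra.
move=> [[A B] /= [nA B0] AB].
have /filter_ex[d [Bd d0]] : \forall d \near 0^'+, B d /\ 0 < d.
  by near=> d; split; near: d; [exact: B0|exact: nbhs_right_gt].
exists d => //; near=> s' => y y' Ky; apply: (AB (s', d)) => //; split => //=.
by near: s'.
Unshelve. all: by end_near. Qed.

(** The values [f z.1] lie in one compact part of [Y] and [f w.1] is close to [f z.1], both
    uniformly in [f]; [compact_tube] then controls [c] along all these values at once. *)
Lemma rkhs_cost_equicontinuous (R : realType) (E : normedModType R) (X : set E) (Y : set R)
  (z0 : X * Y)
  (Zpolish : polish (X * Y)%type)
  (k : X -> X -> R) (H : rkhs k)
  (F : set (X -> Y))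
  (FH : forall f, F f -> rkhs_carrier H (fun x => val (f x)))
  (c : (X * Y) * Y -> R)
  (Ka : forall Z0 : set (X * Y), compact Z0 ->
     let X0 := [set z.1 | z in Z0] in
     forall eps : R, 0 < eps -> exists2 eta : R, 0 < eta &
       forall x x' : X, X0 x -> X0 x' -> `|val x' - val x| < eta ->
         rkhs_norm H (fun t => k t x' - k t x) < eps)
  (beta : R) (beta0 : 0 < beta)
  (Fbeta : forall f, F f -> rkhs_norm H (fun x => val (f x)) <= beta)
  (Cb : continuous c) (z : X * Y) (e : R) : 0 < e ->
  \forall w \near z, forall f, F f -> `|c (w, f w.1) - c (z, f z.1)| < e.
Proof.
move=> e0.
have X0 : X !=set0 by exists (val z0.1); exact: set_valP.
pose M := beta * rkhs_norm H (k^~ z.1).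
have [d d0 dP] := compact_tube z Cb (polish_bounded_compact Zpolish X0 (M := M)) e0.
near=> w => f Ff.
have [fH fb] := (FH f Ff, Fbeta f Ff).
apply: (near dP w) => //=.
- rewrite (le_trans (rkhs_eval_le _ fH))// ler_wpM2r ?rkhs_norm_ge0//.
- rewrite (le_lt_trans (rkhs_evalB_le _ _ fH))//.
  rewrite (@le_lt_trans _ _ (beta * rkhs_norm H (fun t => k t w.1 - k t z.1)))//.
    by rewrite ler_wpM2r ?rkhs_norm_ge0.
  rewrite mulrC -ltr_pdivlMr//.
  near: w.
  have dbeta : 0 < d / beta by rewrite divr_gt0.
  have kn := rkhs_section_continuous z0.2 Ka z.1 dbeta.
  by case: z @M dP kn => x y M dP kn; exact: (@cvg_fst _ _ _ (nbhs y) _ _ kn).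
Unshelve. all: by end_near. Qed.

(** * Integration and the psi-weak topology *)

Lemma borel_continuous_measurable (R : realType) (T : topologicalType) (t0 : T) (f : T -> R) :
  continuous f -> measurable_fun setT (f : borel t0 -> R).
Proof.
move=> /continuousP cf; apply: (measurability _ (RGenOpens.measurableE R)).
move=> _ [_ [a [b ->] <-]]; rewrite setTI; apply: sub_sigma_algebra.
by apply: cf; exact: interval_open.
Qed.

Lemma Rintegral_sum d (T : measurableType d) (R : realType) (mu : {measure set T -> \bar R})
    (D : set T) (I : eqType) (f : I -> T -> R) (s : seq I) :
  measurable D -> (forall i, mu.-integrable D (EFin \o f i)) ->
  \int[mu]_(x in D) (\sum_(i <- s) f i x) = \sum_(i <- s) \int[mu]_(x in D) f i x.
Proof.
move=> mD fi; rewrite /Rintegral.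
under eq_integral do rewrite -sumEFin.
rewrite integral_sum//; elim: s => [|i s IH]; first by rewrite !big_nil.
rewrite !big_cons fineD ?IH//; first exact: (integrable_fin_num mD (fi i)).
by apply/sum_fin_numP => j _ _; exact: (integrable_fin_num mD (fi j)).
Qed.

Section psi_weak_theory.
Context {R : realType} {T : topologicalType} (t0 : T) (psi : T -> R).

Lemma psi_eval_continuous (h : psi_test psi) :
  continuous (psi_eval h : psi_weak t0 psi -> R).
Proof.
move=> P A /(@initial_continuous _ _ (psi_eval h) P).
by have /cvg_sup/(_ h) := @cvg_id _ (nbhs P); exact.
Qed.

Lemma moment_space_integrable (P : moment_space t0 psi) (h : T -> R) (C : R) :
  measurable_fun setT (psi : borel t0 -> R) -> (forall z, 0 <= psi z) ->
  continuous h -> (forall z, `|h z| <= C * (psi z + 1)) ->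
  (val P).-integrable setT (EFin \o (h : borel t0 -> R)).
Proof.
move=> mpsi psi0 ch hC.
have psii : (val P).-integrable setT (EFin \o (psi : borel t0 -> R)).
  apply/integrableP; split; first exact/measurable_EFinP.
  by under eq_integral do rewrite /= ger0_norm//; exact: set_valP P.
have : (val P).-integrable setT (fun z : borel t0 => C%:E * ((EFin \o psi) \+ cst 1%:E) z)%E.
  by apply/integrableZl/integrableD => //; exact: finite_measure_integrable_cst.
apply: le_integrable => //.
  by apply/measurable_EFinP; exact: borel_continuous_measurable.
by move=> z _; rewrite /= lee_fin (le_trans (hC z))// ler_norm.
Qed.


End psi_weak_theory.

(** * A substitute for partitions of unity *)

Section running_max.
Context {R : realType} {T : topologicalType}.
Implicit Type w : nat -> T -> R.

Fixpoint running_max w n z : R :=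
  if n is m.+1 then Num.max (running_max w m z) (w m z) else 0.

Lemma running_max_continuous w n : (forall i, continuous (w i)) -> continuous (running_max w n).
Proof.
move=> cw; elim: n => [|n IH] z.
  exact: cvg_cst.
by apply: continuous_max; [exact: IH|exact: cw].
Qed.

Lemma running_max_ge0 w n z : 0 <= running_max w n z.
Proof.
elim: n => //= n IH.
by rewrite le_max IH.
Qed.

Lemma running_max_le1 w n z : (forall i, w i z <= 1) -> running_max w n z <= 1.
Proof.
move=> w1; elim: n => //= n IH.
by rewrite ge_max IH w1.
Qed.

Lemma le_running_max w n z i : (i < n)%N -> w i z <= running_max w n z.
Proof.
elim: n => //= n IH; rewrite ltnS leq_eqVlt le_max => /orP[/eqP ->|/IH ->//].
by rewrite lexx orbT.
Qed.

(* The increments of the running maximum play the role of a partition of unity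
   subordinate to the supports of the [w i]. *)
Lemma running_max_approx w n z (a : nat -> R) (x b e : R) : (forall i, w i z <= 1) -> 0 <= e ->
  0 <= x <= b -> (forall i, 0 < w i z -> `|x - a i| <= e) ->
  `|x - \sum_(i < n) a i * (running_max w i.+1 z - running_max w i z)|
    <= e + b * (1 - running_max w n z).
Proof.
move=> w1 e0 /andP[x0 xb] xa.
set W := running_max w ^~ z.
have W0 i : 0 <= W i by exact: running_max_ge0.
have W1 i : W i <= 1 by exact: running_max_le1.
have WS i : W i.+1 = Num.max (W i) (w i z) by [].
have Wz : W 0 = 0 by [].
rewrite -/(W n); under eq_bigr do
  rewrite -[running_max _ _ _]/(W _) -[running_max w (nat_of_ord _) z]/(W _).
move: W W0 W1 WS Wz => W W0 W1 WS Wz.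
(* The increments telescope to [W n]. The one from [n] to [n.+1] is nonzero only if
   [w n z > W n >= 0], and then [a n] is within [e] of [x]. *)
have : `|x * W n - \sum_(i < n) a i * (W i.+1 - W i)| <= e * W n.
  elim: n => [|n IH].
    by rewrite big_ord0 Wz !mulr0 subr0 normr0.
  rewrite big_ord_recr /=.
  have : `|(x - a n) * (W n.+1 - W n)| <= e * (W n.+1 - W n).
    rewrite normrM.
    rewrite WS.
    have [wW|Ww] := leP (w n z) (W n); first by rewrite subrr normr0 !mulr0.
    rewrite (ger0_norm (x := w n z - W n)) ?subr_ge0 ?(ltW Ww)//.
    by rewrite ler_wpM2r ?subr_ge0 ?(ltW Ww)// xa// (le_lt_trans (W0 n)).
  move: IH; rewrite !ler_norml; lra.
(* The part of [x] not reached by the increments, controlled only by [0 <= x <= b]. *)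
have : x * (1 - W n) <= b * (1 - W n) by rewrite ler_wpM2r// subr_ge0.
have : 0 <= x * (1 - W n) by rewrite mulr_ge0// subr_ge0.
have : e * W n <= e by rewrite ler_piMr.
rewrite !ler_norml; lra.
Qed.

(** [N] is both the number of functions and their scaling factor: the value [1] is attained once
    [N > n] and [N * w n z >= 1]. *)
Lemma running_max_eventually1 w z n :
  0 < w n z -> \forall N \near \oo, running_max (fun i t => Num.min 1 (N%:R * w i t)) N z = 1.
Proof.
move=> w0; near=> N; apply/eqP; rewrite eq_le running_max_le1/=; last first.
  by move=> i; rewrite ge_min lexx.
apply: le_trans (le_running_max _ _ (i := n) _); last by near: N; exact: nbhs_infty_gt.
rewrite le_min lexx/= -ler_pdivrMr// mul1r.
by near: N; exact: nbhs_infty_ger.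
Unshelve. all: by end_near. Qed.

End running_max.

(** * Uniform convergence of integrals *)

Section uniform_convergence.
Context {R : realType} {T : topologicalType} (t0 : T) (psi phi : T -> R).
Hypothesis mpsi : measurable_fun setT (psi : borel t0 -> R).
Hypothesis psi0 : forall z, 0 <= psi z.
Hypothesis cphi : continuous phi.
Hypothesis phi0 : forall z, 0 <= phi z.
Hypothesis phi_psi : forall z, phi z <= psi z + 1.

Lemma dominated_integrable_moment (P : moment_space t0 psi) (g : T -> R) :
  continuous g -> (forall z, `|g z| <= psi z + 1) ->
  (val P).-integrable setT (EFin \o (g : borel t0 -> R)).
Proof.
by move=> cg gp; apply: (@moment_space_integrable _ _ _ _ P g 1) => // z; rewrite mul1r.
Qed.

Lemma dominated_psi_eval_continuous (g : T -> R) :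
  continuous g -> (forall z, `|g z| <= psi z + 1) ->
  continuous (fun P : psi_weak t0 psi => \int[val P]_z g z).
Proof.
move=> cg gp.
have gt : continuous g /\ exists2 C : R, 0 < C & forall z, `|g z| <= C * (psi z + 1).
  by split => //; exists 1 => // z; rewrite mul1r.
exact: (@psi_eval_continuous _ _ t0 psi (exist _ g gt)).
Qed.

(** The pointwise estimate [running_max_approx], with [x = g z] and [b = phi z], is integrated. The
    [a i] and [w i] do not depend on [P], so the same approximation serves all measures. *)
Lemma running_max_approx_integral (P : moment_space t0 psi) (w : nat -> T -> R) (n : nat)
    (a : nat -> R) (g : T -> R) (e : R) :
  (forall i, continuous (w i)) -> (forall i z, w i z <= 1) -> 0 <= e ->
  continuous g -> (forall z, 0 <= g z <= phi z) ->
  (forall i z, 0 < w i z -> `|g z - a i| <= e) ->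
  `|\int[val P]_z g z - \sum_(i < n) a i *
       \int[val P]_z (running_max w i.+1 z - running_max w i z)|
    <= e + \int[val P]_z (phi z * (1 - running_max w n z)).
Proof.
move=> cw w1 e0 cg gphi ga.
have W01 i z : 0 <= running_max w i z <= 1.
  by rewrite running_max_ge0 running_max_le1.
have cW i : continuous (running_max w i) by exact: running_max_continuous.
pose v i z := running_max w i.+1 z - running_max w i z.
have cv i : continuous (v i) by move=> z; apply: cvgB; exact: cW.
have vi i : (val P).-integrable setT (EFin \o (v i : borel t0 -> R)).
  apply: dominated_integrable_moment => // z; have := psi0 z.
  have := W01 i z; have := W01 i.+1 z; rewrite /v ler_norml; lra.
have gi : (val P).-integrable setT (EFin \o (g : borel t0 -> R)).
  apply: dominated_integrable_moment => // z; have := gphi z.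
  have := phi_psi z; rewrite ler_norml; lra.
have ch : continuous (fun z => phi z * (1 - running_max w n z)).
  by move=> z; apply: cvgM; [exact: cphi|apply: cvgB; [exact: cvg_cst|exact: cW]].
have hi : (val P).-integrable setT
    (EFin \o ((fun z => phi z * (1 - running_max w n z)) : borel t0 -> R)).
  apply: dominated_integrable_moment => // z; have /andP[W0 W1] := W01 n z.
  rewrite ger0_norm ?mulr_ge0 ?subr_ge0//; apply: le_trans (phi_psi z).
  by rewrite ler_piMr// gerBl.
have avi i : (val P).-integrable setT (EFin \o ((fun z => a i * v i z) : borel t0 -> R)).
  by have := integrableZl measurableT (a i) (vi i); apply: eq_integrable.
have si : (val P).-integrable setT
    (EFin \o ((fun z => \sum_(i < n) a i * v i z) : borel t0 -> R)).
  have := @integrable_sum _ _ _ (val P) _ measurableT 'I_n (index_enum 'I_n) xpredT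
    (fun i => EFin \o (fun z : borel t0 => a i * v i z)) (fun i _ => avi i).
  by apply: eq_integrable => // z _; rewrite /= sumEFin.
have ei : (val P).-integrable setT (EFin \o (cst e : borel t0 -> R)).
  exact: finite_measure_integrable_cst.
have -> : \sum_(i < n) a i * \int[val P]_z (running_max w i.+1 z - running_max w i z)
    = \int[val P]_z (\sum_(i < n) a i * v i z).
  rewrite Rintegral_sum//; apply: eq_bigr => i _.
  by rewrite RintegralZl.
(* The total mass is [1], so [e] can join the other terms under one integral. *)
have -> : e = \int[val P]_z (cst e z).
  rewrite Rintegral_cst// -[LHS]mulr1; congr (_ * _).
  by rewrite -[LHS]/(fine 1%E); congr fine; exact/esym/probability_setT.
rewrite -RintegralB// -RintegralD//.
apply: le_trans; first apply: le_normr_Rintegral => //.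
  by have := integrableB measurableT gi si; apply: eq_integrable.
apply: le_Rintegral => //.
- have := integrable_abse (integrableB measurableT gi si).
  by apply: eq_integrable.
- by have := integrableD measurableT ei hi; apply: eq_integrable.
move=> z _ /=; apply: running_max_approx => // i; exact: ga.
Qed.

(** Dominated convergence: at each point the integrand is eventually [0], and it is at most [phi],
    which is integrable because [phi <= psi + 1]. *)
Lemma running_max_tail (P : moment_space t0 psi) (w : nat -> T -> R) (e : R) :
  (forall i, continuous (w i)) -> (forall z, exists i, 0 < w i z) -> 0 < e ->
  exists N : nat,
    \int[val P]_z (phi z * (1 - running_max (fun i t => Num.min 1 (N%:R * w i t)) N z)) < e.
Proof.
move=> cw w0 e0.
pose u (N : nat) z := phi z * (1 - running_max (fun i t => Num.min 1 (N%:R * w i t)) N z).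
have cu N : continuous (u N).
  move=> z; apply: cvgM; first exact: cphi.
  apply: cvgB; first exact: cvg_cst.
  apply: running_max_continuous => i t.
  apply: (@continuous_min _ _ (cst 1) (fun t => N%:R * w i t)); first exact: cvg_cst.
  by apply: cvgM; [exact: cvg_cst|exact: cw].
have u01 N z : 0 <= u N z <= phi z.
  rewrite /u mulr_ge0//= ?ler_piMr// ?subr_ge0 ?gerBl ?running_max_ge0//.
  by apply: running_max_le1 => i; rewrite ge_min lexx.
have phii : (val P).-integrable setT (EFin \o (phi : borel t0 -> R)).
  by apply: dominated_integrable_moment => // z; rewrite ger0_norm.
have [] := @dominated_convergence _ (borel t0) R (val P) setT measurableT
  (fun N => EFin \o u N) (cst 0%E) (EFin \o phi).
- by move=> N; apply/measurable_EFinP; exact: borel_continuous_measurable.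
- exact: measurable_cst.
- apply: aeW => z _; have [i wi] := w0 z; apply: cvg_near_cst.
  apply: filterS (running_max_eventually1 wi) => N.
  by rewrite /u /= => ->; rewrite subrr mulr0.
- exact: phii.
- by apply: aeW => z N _ /=; have /andP[u0 u1] := u01 N z; rewrite lee_fin ger0_norm.
move=> _ _; rewrite integral_cst// mul0e => /fine_cvgP[_] /cvgrPdist_lt /(_ _ e0).
move=> /filter_ex[N]; rewrite /= sub0r normrN => /ltr_normlW uN; exists N.
exact: uN.
Qed.

Lemma psi_weak_uniform_integral (G : set (T -> R)) (P : psi_weak t0 psi) :
  (forall g, G g -> continuous g) -> (forall g z, G g -> 0 <= g z <= phi z) ->
  (forall e, 0 < e -> exists w : nat -> T -> R, exists c : nat -> T,
    [/\ forall i, continuous (w i), forall z, exists i, 0 < w i z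
      & forall g i z, G g -> 0 < w i z -> `|g z - g (c i)| <= e]) ->
  forall e : R, 0 < e -> \forall Q \near P, forall g, G g ->
    `|\int[val (Q : psi_weak t0 psi)]_z g z - \int[val P]_z g z| <= e.
Proof.
(* For each of [P] and [Q] the approximation costs [e1] plus a tail below [e1]; comparing the two
   finite sums costs the fifth [e1]. *)
move=> Gc Gphi osc e e0; pose e1 := e / 5.
have e10 : 0 < e1 by rewrite divr_gt0.
have [w [c [cw w0 wc]]] := osc _ e10.
have [N PN] := running_max_tail P cw w0 e10.
pose w' i t := Num.min 1 (N%:R * w i t).
have cw' i : continuous (w' i).
  move=> t; apply: (@continuous_min _ _ (cst 1) (fun t => N%:R * w i t)); first exact: cvg_cst.
  by apply: cvgM; [exact: cvg_cst|exact: cw].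
have w'1 i z : w' i z <= 1 by rewrite ge_min lexx.
have w'0 i z : 0 < w' i z -> 0 < w i z.
  by rewrite lt_min ltr01/=; apply: contraTT; rewrite -!leNgt; exact: mulr_ge0_le0.
have W01 i z : 0 <= running_max w' i z <= 1.
  by rewrite running_max_ge0 running_max_le1.
have cW i : continuous (running_max w' i) by exact: running_max_continuous.
pose I i (Q : psi_weak t0 psi) := \int[val Q]_z (running_max w' i.+1 z - running_max w' i z).
have cI i : continuous (I i).
  apply: dominated_psi_eval_continuous => z.
    by apply: cvgB; exact: cW.
  have := W01 i z; have := W01 i.+1 z; have := psi0 z; rewrite ler_norml; lra.
(* The tail integrand is a test function, so its smallness at [P] persists for nearby [Q]. *)
have near1 : \forall Q \near P,
    \int[val (Q : psi_weak t0 psi)]_z (phi z * (1 - running_max w' N z)) < e1.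
  have ch : continuous (fun Q : psi_weak t0 psi =>
      \int[val Q]_z (phi z * (1 - running_max w' N z))).
    apply: dominated_psi_eval_continuous => z.
      by apply: cvgM; [exact: cphi|apply: cvgB; [exact: cvg_cst|exact: cW]].
    have /andP[W0 W1] := W01 N z.
    rewrite ger0_norm ?mulr_ge0 ?subr_ge0//; apply: le_trans (phi_psi z).
    by rewrite ler_piMr// gerBl.
  exact: (cvgr_lt _ (ch P)).
(* The weight [phi (c i)] bounds [g (c i)] for every [g] in [G], so this neighbourhood of [P] does
   not depend on [g]. *)
have near2 : \forall Q \near P, \sum_(i < N) phi (c i) * `|I i Q - I i P| < e1.
  have : \sum_(i < N) phi (c i) * `|I i Q - I i P| @[Q --> P] -->
         \sum_(i < N) phi (c i) * `|I i P - I i P|.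
    apply: (@cvg_big _ _ _ _ _ add_continuous _ (nbhs P)) => i _.
    apply: cvgM; first exact: cvg_cst.
    by apply: cvg_norm; apply: cvgB; [exact: cI|exact: cvg_cst].
  move=> /cvgr_lt; apply; rewrite big1// => i _.
  by rewrite subrr normr0 mulr0.
near=> Q => g Gg.
have approx (Q' : psi_weak t0 psi) := @running_max_approx_integral Q' w' N (g \o c) g e1
  cw' w'1 (ltW e10) (Gc _ Gg) (fun z => Gphi _ z Gg)
  (fun i z wi => wc g i z Gg (w'0 _ _ wi)).
have aQ := approx Q; have aP := approx P.
have hQ : \int[val Q]_z (phi z * (1 - running_max w' N z)) < e1 by near: Q.
have sQ : \sum_(i < N) phi (c i) * `|I i Q - I i P| < e1 by near: Q.
have : `|\sum_(i < N) g (c i) * I i Q - \sum_(i < N) g (c i) * I i P| < e1.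
  apply: le_lt_trans sQ; rewrite -sumrB (le_trans (ler_norm_sum _ _ _))//.
  apply: ler_sum => i _; rewrite -mulrBr normrM ler_wpM2r//.
  by have /andP[g0 g1] := Gphi g (c i) Gg; rewrite ger0_norm.
move: aQ aP PN hQ; rewrite -/w' /= -/(I _ Q) -/(I _ P).
set x := \sum_(i < N) _; set y := \sum_(i < N) _.
have : e = 5 * e1 by rewrite /e1; field.
rewrite !ler_norml !ltr_norml; lra.
Unshelve. all: by end_near. Qed.

End uniform_convergence.

(** * Countable covers by sets of small oscillation *)

Section separable_cover.
Context {R : realType} {E : normedModType R} (X : set E) (Y : set R).
Implicit Types s t z : (X * Y)%type.

Definition prod_dist s t : R := Num.max `|val s.1 - val t.1| `|val s.2 - val t.2|.

Lemma nbhs_prod_distP z (B : set (X * Y)) :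
  nbhs z B <-> exists2 r : R, 0 < r & forall t, prod_dist t z < r -> B t.
Proof.
case: z => x y; split.
  move=> [[U V] /= [/nbhs_set_typeP[r r0 rU] /nbhs_set_typeP[r' r'0 rV]] UV].
  exists (Num.min r r'); first by rewrite lt_min r0.
  move=> [s t]; rewrite /prod_dist gt_max !lt_min /= => /andP[/andP[? _] /andP[_ ?]].
  by apply: UV; split => /=; [exact: rU|exact: rV].
move=> [r r0 rB].
exists ([set s : X | `|val s - val x| < r], [set t : Y | `|val t - val y| < r]) => /=.
  by split; apply/nbhs_set_typeP; exists r.
by move=> [s t] [/= ? ?]; apply: rB; rewrite /prod_dist gt_max; apply/andP.
Qed.

Lemma prod_distC s t : prod_dist s t = prod_dist t s.
Proof. by rewrite /prod_dist distrC (distrC (val s.2)). Qed.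

Lemma prod_dist_triangle s t z : prod_dist s t <= prod_dist s z + prod_dist z t.
Proof.
rewrite /prod_dist ge_max; apply/andP; split.
- by apply: le_trans (ler_distD (val z.1) _ _) _; rewrite lerD// le_max lexx.
- by apply: le_trans (ler_distD (val z.2) _ _) _; rewrite lerD// le_max lexx orbT.
Qed.

Lemma prod_dist_continuous t : continuous (prod_dist ^~ t).
Proof.
move=> z; apply: (@continuous_max _ _ (fun s => `|val s.1 - val t.1|)
  (fun s => `|val s.2 - val t.2|)).
- apply: cvg_norm; apply: cvgB; last exact: cvg_cst.
  by apply: continuous_comp; [exact: cvg_fst|exact: set_type_continuous_val].
- apply: cvg_norm; apply: cvgB; last exact: cvg_cst.
  by apply: continuous_comp; [exact: cvg_snd|exact: set_type_continuous_val].
Qed.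

(** Balls with centre in [D] and radius [1 / (m + 1)] are countably many. Those on which every [g]
    stays within [e] of its value at the centre still cover, by equicontinuity and density. *)
Lemma equicontinuous_countable_cover (D : set (X * Y)) (G : set (X * Y -> R)) (z0 : X * Y) :
  countable D -> dense D ->
  (forall z e, 0 < e -> \forall t \near z, forall g, G g -> `|g t - g z| < e) ->
  forall e : R, 0 < e -> exists w : nat -> X * Y -> R, exists c : nat -> X * Y,
    [/\ forall i, continuous (w i), forall z, exists i, 0 < w i z
      & forall g i z, G g -> 0 < w i z -> `|g z - g (c i)| <= e].
Proof.
move=> cD dD eqG e e0.
pose A := [set p : (X * Y) * nat | D p.1 /\
  forall g z, G g -> prod_dist z p.1 < p.2.+1%:R^-1 -> `|g z - g p.1| <= e].
have cover z : exists2 p, A p & prod_dist z p.1 < p.2.+1%:R^-1.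
  have e20 : 0 < e / 2 by rewrite divr_gt0.
  have /nbhs_prod_distP[r r0 rG] := eqG z _ e20.
  have r20 : 0 < r / 2 by rewrite divr_gt0.
  have /filter_ex[m mr] := near_infty_natSinv_lt (PosNum r20).
  have nz : nbhs z [set t | prod_dist t z < m.+1%:R^-1].
    by apply/nbhs_prod_distP; exists m.+1%:R^-1.
  (* As [1 / (m + 1) < r / 2], the ball of this radius about [d] lies in the [r]-ball about [z],
     where every [g] is within [e / 2] of [g z]. *)
  have [||d [/interior_subset dz Dd]] := dD ([set t | prod_dist t z < m.+1%:R^-1]^°).
  - by exists z.
  - exact: open_interior.
  exists (d, m); last by rewrite prod_distC.
  split => //= g t Gg td.
  have gt : `|g t - g z| < e / 2.
    apply: rG => //; apply: le_lt_trans (prod_dist_triangle _ _ d) _.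
    by rewrite (splitr r) ltrD//; [exact: lt_trans td mr|exact: lt_trans dz mr].
  have gd : `|g d - g z| < e / 2.
    by apply: rG => //; apply: lt_trans dz (lt_trans mr _); rewrite ltr_pdivrMr// ltr_pMr// ltr1n.
  have := ler_distD (g z) (g t) (g d); rewrite (distrC (g z)); lra.
have cA : countable A.
  apply: sub_countable (countableX cD (countableP [set: nat])).
  by apply: subset_card_le => p [].
(* An enumeration with possible repetitions; [A] is nonempty since it covers [z0]. *)
have [s sA] : exists s : nat -> (X * Y) * nat, A = range s.
  have [p Ap _] := cover z0; have /pfcard_geP[A0|/surjfunPex[s sA]] := cA.
    by rewrite A0 in Ap.
  by exists s.
(* Radius minus distance to the centre: continuous, and positive exactly on the ball. *)
exists (fun i z => (s i).2.+1%:R^-1 - prod_dist z (s i).1), (fun i => (s i).1).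
split.
- by move=> i z; apply: cvgB; [exact: cvg_cst|exact: prod_dist_continuous].
- move=> z; have [p] := cover z; rewrite sA => -[i _ <-] zi.
  by exists i; rewrite subr_gt0.
- move=> g i z Gg; rewrite subr_gt0.
  by have [_ As] : A (s i) by [rewrite sA; exists i]; exact: As.
Qed.
End separable_cover.

(** * Infima of uniformly close families *)

Section ereal_inf_image.
Context {R : realType} {I : Type} (F : set I).
Implicit Types a b : I -> R.

Lemma ereal_inf_image_fin_num a : F !=set0 -> (forall i, F i -> 0 <= a i) ->
  ereal_inf [set (a i)%:E | i in F] \is a fin_num.
Proof.
move=> [i Fi] a0; rewrite ge0_fin_numE.
  by apply: (@le_lt_trans _ _ (a i)%:E); [apply: ereal_inf_lbound; exists i|rewrite ltry].
by apply: le_ereal_inf_tmp => _ [j Fj <-]; rewrite lee_fin a0.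
Qed.

Lemma ereal_inf_image_le a b (e : R) : (forall i, F i -> a i <= b i + e) ->
  (ereal_inf [set (a i)%:E | i in F] <= ereal_inf [set (b i)%:E | i in F] + e%:E)%E.
Proof.
move=> ab; rewrite -leeBlDr//; apply: le_ereal_inf_tmp => _ [i Fi <-].
rewrite leeBlDr//; apply: (@le_trans _ _ (a i)%:E).
  by apply: ereal_inf_lbound; exists i.
by rewrite -EFinD lee_fin ab.
Qed.

Lemma ereal_inf_image_dist a b (e : R) : F !=set0 ->
  (forall i, F i -> 0 <= a i) -> (forall i, F i -> 0 <= b i) ->
  (forall i, F i -> `|a i - b i| <= e) ->
  `|fine (ereal_inf [set (a i)%:E | i in F]) - fine (ereal_inf [set (b i)%:E | i in F])| <= e.
Proof.
move=> F0 a0 b0 ab.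
have fa := ereal_inf_image_fin_num F0 a0; have fb := ereal_inf_image_fin_num F0 b0.
have leab : (ereal_inf [set (a i)%:E | i in F] <= ereal_inf [set (b i)%:E | i in F] + e%:E)%E.
  by apply: ereal_inf_image_le => i /ab; rewrite ler_norml; lra.
have leba : (ereal_inf [set (b i)%:E | i in F] <= ereal_inf [set (a i)%:E | i in F] + e%:E)%E.
  by apply: ereal_inf_image_le => i /ab; rewrite ler_norml; lra.
move: leab leba; rewrite -(fineK fa) -(fineK fb) -!EFinD !lee_fin ler_norml /=; lra.
Qed.

End ereal_inf_image.

(** This makes functions dominated by [phi] admissible tests for [phi ^ p]. *)
Lemma le_powR_add1 (R : realType) (x p : R) : 0 <= x -> 1 <= p -> x <= x `^ p + 1.
Proof.
move=> x0 p1; have [x1|/ltW x1] := leP x 1.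
  by rewrite (le_trans x1)// lerDr powR_ge0.
by rewrite -[leLHS]powRr1// ler_wpDr// ler_powR.
Qed.

(** * Continuity of the optimal value *)

Theorem theorem3p1 (R : realType) (E : normedModType R)
  (X : set E) (Y : set R) (z0 : X * Y)
  (Zpolish : polish (X * Y)%type)
  (k : X -> X -> R) (kpsd : psd_kernel k) (H : rkhs k)
  (F : set (X -> Y)) (F0 : F !=set0)
  (FH : forall f, F f -> rkhs_carrier H (fun x => val (f x)))
  (c : (X * Y) * Y -> R)
  (c0 : forall f (z : X * Y), F f -> 0 <= c (z, f z.1))
  (Ka : forall Z0 : set (X * Y), compact Z0 ->
     let X0 := [set z.1 | z in Z0] in
     forall eps : R, 0 < eps -> exists2 eta : R, 0 < eta &
       forall x x' : X, X0 x -> X0 x' -> `|val x' - val x| < eta ->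
         rkhs_norm H (fun t => k t x' - k t x) < eps)
  (Kb : exists2 beta : R, 0 < beta &
     forall f, F f -> rkhs_norm H (fun x => val (f x)) <= beta)
  (phi : X * Y -> R) (phi_gauge : gauge phi)
  (Ca : forall f (z : X * Y), F f -> c (z, f z.1) <= phi z)
  (phi_coercive : forall M : R, exists r : R, forall z : X * Y,
     r <= `|(val z.1, val z.2) : E * R| -> M <= phi z)
  (Cb : continuous c)
  (p : R) (p1 : 1 <= p) :
  let theta := fun P : psi_weak z0 (fun z => phi z `^ p) => optval c F (val P) in
  forall P : psi_weak z0 (fun z => phi z `^ p),
    theta P \is a fin_num /\ {for P, continuous theta}.
Proof.
move=> theta P.
have [beta beta0 Fbeta] := Kb; have [cphi phi0 _] := phi_gauge.
have [_ [D cD dD] _] := Zpolish.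
pose psi z := phi z `^ p.
have psi0 z : 0 <= psi z by exact: powR_ge0.
have mpsi : measurable_fun setT (psi : borel z0 -> R).
  apply: (measurableT_comp (measurable_powR _)).
  exact: borel_continuous_measurable.
have phi_psi z : phi z <= psi z + 1 by exact: le_powR_add1.
pose cost f (z : X * Y) := c (z, f z.1).
pose G := cost @` F.
have eqG (z : X * Y) (e : R) : 0 < e ->
    \forall t \near z, forall g, G g -> `|g t - g z| < e.
  move=> e0.
  have := rkhs_cost_equicontinuous z0 Zpolish FH Ka beta0 Fbeta Cb z e0.
  by apply: filterS => t ct _ [f Ff <-]; exact: ct.
have cG g : G g -> continuous g.
  move=> Gg z; apply/cvgrPdist_lt => e e0; apply: filterS (eqG z e e0) => t.
  by move=> /(_ g Gg); rewrite distrC.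
have Gphi g z : G g -> 0 <= g z <= phi z.
  by move=> [f Ff <-]; rewrite c0// Ca.
(* The costs are integrable for every [Q] of the moment space, so the extended expectations are real
   integrals. *)
have thetaE (Q : psi_weak z0 psi) :
    theta Q = ereal_inf [set (\int[val Q]_z cost f z)%:E | f in F].
  congr ereal_inf; apply: eq_imagel => f Ff.
  have Gf : G (cost f) by exists f.
  rewrite unlock fineK//; apply: integrable_fin_num => //.
  apply: (dominated_integrable_moment mpsi psi0 _ (cG _ Gf)) => z.
  by have /andP[g0 g1] := Gphi _ z Gf; rewrite ger0_norm// (le_trans g1).
have int0 (Q : psi_weak z0 psi) f : F f -> 0 <= \int[val Q]_z cost f z.
  by move=> Ff; apply: Rintegral_ge0 => z _; exact: c0.
have theta_fin Q : theta Q \is a fin_num.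
  by rewrite thetaE; apply: ereal_inf_image_fin_num => // f; exact: int0.
split => //.
(* All values of [theta] are finite, which reduces the limit in the extended reals to one in [R]. *)
suff : theta Q @[Q --> P] --> (fine (theta P))%:E by rewrite fineK.
apply: (@cvg_EFin _ _ (nbhs P)); first exact: (@filterE _ (nbhs P) _ _ theta_fin).
apply/cvgrPdist_le => e e0.
have := psi_weak_uniform_integral mpsi psi0 cphi phi0 phi_psi P cG Gphi
  (equicontinuous_countable_cover z0 cD dD eqG) e0.
apply: filterS => Q PQ; rewrite /= !thetaE; apply: ereal_inf_image_dist => //.
- by move=> f; exact: int0.
- by move=> f; exact: int0.
- by move=> f Ff; rewrite distrC; apply: PQ; exists f.
Qed.
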